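(* Let $n\ge 1$ and $0\le \ell\le n$ be integers, let $C$ be a real number, and let $A,B\in\mathbb{C}^{n\times n}$ satisfy $\|A\|_F\le n$, $\|B\|_F\le Cn$, and $\mathrm{rank}(B)\le \ell$. Then $$|\det(A+B)| \le \frac{n^n}{(n-\ell)^{\frac{n-\ell}{2}}\,\ell^{\frac{\ell}{2}}}\,(1+C)^\ell .$$
   Context: $\|\cdot\|_F$ denotes the Frobenius norm. The convention $0^0=1$ is used. *)

(* Defs.v *)
From mathcomp Require Import all_boot all_order all_algebra.
From mathcomp Require Import complex.
From mathcomp Require Import reals exp.

Set Implicit Arguments.
Unset Strict Implicit.
Unset Printing Implicit Defensive.

Import Order.TTheory GRing.Theory Num.Theory.

Local Open Scope ring_scope.
Local Open Scope complex_scope.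

(* [Normc.normc] is the modulus with values in [R]; the generic norm [`|z|] on
   [R[i]] takes values in [R[i]]. *)
Definition frobenius_norm (R : realType) (m n : nat) (A : 'M[R[i]]_(m, n)) : R :=
  Num.sqrt (\sum_(i < m) \sum_(j < n) Normc.normc (A i j) ^+ 2).

(* Main.v *)
(* Let U be a unitary matrix obtained by Gram-Schmidt from a basis whose first
   rank B vectors span the row space of B.  Then all columns of B U^* of index
   >= l vanish, so those columns of (A + B) U^* are columns of A U^* and their
   squared norms sum to at most n^2, while the squared norms of the first l
   columns sum to at most ||A + B||_F^2 <= (n (1 + C))^2.  Hadamard's
   inequality, followed by AM-GM on each of the two groups of columns, gives
   the bound. *)
Require Import Defs.
From mathcomp Require Import all_boot all_order all_algebra.
From mathcomp Require Import complex.
From mathcomp Require Import reals exp.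
From mathcomp Require Import spectral ring.

Set Implicit Arguments.
Unset Strict Implicit.
Unset Printing Implicit Defensive.

Import Order.TTheory GRing.Theory Num.Theory.

Local Open Scope ring_scope.
Local Open Scope complex_scope.

Section Unitary.
Local Open Scope sesquilinear_scope.
Variable K : numClosedFieldType.

(** Row [i] of [A] lies in the span of the rows of [schmidt A] of index at most [i], and these are
    orthogonal to row [j] when [j > i]. The product is the triangular factor of an LQ
    decomposition. *)
Lemma mul_trmxC_schmidt_trig n (A : 'M[K]_n) :
  is_trig_mx (A *m (schmidt A)^t*).
Proof.
apply/is_trig_mxP => i j lt_ij; rewrite !mxE.
have : (row i A <= kermx ((row j (schmidt A))^t*))%MS.
  apply: submx_trans (row_schmidt_sub A i) _.
  apply/sumsmx_subP => k le_ki; rewrite genmxE; apply/sub_kermxP.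
  have /row_unitarymxP/(_ k j) := schmidt_unitarymx A (leqnn n).
  rewrite dotmxE (_ : k == j = false); last first.
    by apply/negbTE; rewrite -val_eqE neq_ltn (leq_ltn_trans le_ki lt_ij).
  by move=> E; apply/matrixP => a b; rewrite !ord1 E mxE.
move=> /sub_kermxP/matrixP/(_ 0 0); rewrite !mxE => E; rewrite -[RHS]E.
by apply: eq_bigr => k _; rewrite !mxE.
Qed.

Lemma row_sqnorm_unitary m n (A : 'M[K]_(m, n)) (U : 'M[K]_n) i :
  U \is unitarymx ->
  \sum_j `|(A *m U^t*) i j| ^+ 2 = \sum_j `|A i j| ^+ 2.
Proof.
move=> Uu.
have E (M : 'M[K]_(m, n)) : \sum_j `|M i j| ^+ 2 = (M *m M^t*) i i.
  by rewrite mxE; apply: eq_bigr => j _; rewrite !mxE normCK.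
by rewrite !E trmx_mul map_mxM trmxCK mulmxA mulmxKtV.
Qed.

Lemma norm_det_unitary n (U : 'M[K]_n) : U \is unitarymx -> `|\det U| = 1.
Proof.
move=> /unitarymxP/(congr1 determinant).
rewrite det_mulmx det_map_mx det_tr det1 -normCK => /eqP.
by rewrite sqrp_eq1 // => /eqP.
Qed.

Lemma norm_det_mul_unitary n (A U : 'M[K]_n) :
  U \is unitarymx -> `|\det (A *m U^t*)| = `|\det A|.
Proof.
move=> Uu; rewrite det_mulmx normrM [X in _ * X]norm_det_unitary ?mulr1 //.
by rewrite trmxC_unitary.
Qed.

(** Multiplying by the adjoint of [schmidt A] makes [A] triangular and keeps both the modulus of the
    determinant and the row norms; a diagonal entry is at most the norm of its row. *)
Lemma hadamard_row n (A : 'M[K]_n) :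
  `|\det A| ^+ 2 <= \prod_i \sum_j `|A i j| ^+ 2.
Proof.
have Su := schmidt_unitarymx A (leqnn n).
rewrite -(norm_det_mul_unitary A Su) det_trig ?mul_trmxC_schmidt_trig //.
rewrite normr_prod -prodrXl; apply: ler_prod => i _.
rewrite exprn_ge0 //= -(row_sqnorm_unitary A i Su) (bigD1 i) //= lerDl.
by apply: sumr_ge0 => j _; rewrite exprn_ge0.
Qed.

(** In the factorization of [B] through [pid_mx (\rank B)], only the rows of [row_ebase B] of index
    [k < \rank B] survive. Their images form rows of a lower triangular matrix, so they vanish in
    column [j > k]. *)
Lemma mul_trmxC_schmidt_row_ebase0 m n (B : 'M[K]_(m, n)) i (j : 'I_n) :
  (\rank B <= j)%N -> (B *m (schmidt (row_ebase B))^t*) i j = 0.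
Proof.
move=> le_rj; rewrite -{1}[B]mulmx_ebase -!mulmxA mxE big1 // => k _.
rewrite mxE big1 ?mulr0 // => h _; rewrite mxE.
have [kh|] := eqVneq (k : nat) h; last by rewrite mul0r.
have [lt_kr|_] := ltnP; last by rewrite mul0r.
have /is_trig_mxP-> := mul_trmxC_schmidt_trig (row_ebase B).
  by rewrite mulr0.
by rewrite -kh (leq_trans lt_kr le_rj).
Qed.

End Unitary.

(** AM-GM with the sum replaced by an upper bound. For empty [P] both sides are 1, which covers
    [l = 0] and [l = n] below. *)
Lemma prod_le_mean_exp (F : numFieldType) (I : finType) (P : pred I)
    (E : I -> F) (S : F) :
  (forall i, 0 <= E i) -> \sum_(i | P i) E i <= S ->
  \prod_(i | P i) E i <= (S / #|P|%:R) ^+ #|P|.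
Proof.
move=> E0 ES; have [H _] := leif_AGM (A := P) (E := E) (fun i _ => E0 i).
apply: le_trans H _; apply: lerXn2r; rewrite ?nnegrE.
- by rewrite divr_ge0 ?ler0n // sumr_ge0.
- by rewrite divr_ge0 ?ler0n // (le_trans _ ES) // sumr_ge0.
- by rewrite ler_wpM2r // invr_ge0.
Qed.

Lemma card_ord_lt n l : (l <= n)%N -> #|[pred i : 'I_n | (i < l)%N]| = l.
Proof.
by move=> ln; rewrite -sum1_card -(big_ord_widen n (fun=> 1%N) ln) sum1_card card_ord.
Qed.

Lemma card_ord_ge n l : (l <= n)%N -> #|[pred i : 'I_n | ~~ (i < l)%N]| = (n - l)%N.
Proof.
move=> ln; apply: (@addnI l).
rewrite -{1}(card_ord_lt ln) subnKC // -[RHS]card_ord.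
exact: (cardC [pred i : 'I_n | (i < l)%N]).
Qed.

Lemma det_add_low_rank_bound (K : numClosedFieldType) n l (A B : 'M[K]_n)
    (a s : K) :
  (l <= n)%N -> (\rank B <= l)%N ->
  \sum_i \sum_j `|A i j| ^+ 2 <= a ->
  \sum_i \sum_j `|(A + B) i j| ^+ 2 <= s ->
  `|\det (A + B)| ^+ 2 <= (s / l%:R) ^+ l * (a / (n - l)%:R) ^+ (n - l).
Proof.
move=> ln rB leA leS; set U := schmidt (row_ebase B).
have Uu : U \is unitarymx by exact: schmidt_unitarymx.
(* Right multiplication by the adjoint of [U] keeps the total squared norm, and any subset of
   columns carries at most this total. *)
have total (M : 'M[K]_n) (P : pred 'I_n) (b : K) :
    \sum_i \sum_j `|M i j| ^+ 2 <= b ->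
    \sum_(j | P j) \sum_i `|(M *m map_mx Num.conj U^T) i j| ^+ 2 <= b.
  move=> leb; apply: le_trans leb.
  rewrite -(eq_bigr _ (fun i _ => row_sqnorm_unitary M i Uu)).
  rewrite [leRHS]exchange_big /=.
  rewrite [leRHS](bigID P) /= lerDl.
  by do 2![apply: sumr_ge0 => ? _]; rewrite exprn_ge0.
(* Transposing turns the row form of Hadamard's inequality into the column form. *)
rewrite -(norm_det_mul_unitary (A + B) Uu) -det_tr.
apply: le_trans (hadamard_row _) _.
rewrite (eq_bigr (fun j =>
  \sum_i `|((A + B) *m map_mx Num.conj U^T) i j| ^+ 2)); last first.
  by move=> j _; apply: eq_bigr => i _; rewrite mxE.
have E0 (M : 'M[K]_n) j : 0 <= \sum_i `|M i j| ^+ 2.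
  by apply: sumr_ge0 => i _; rewrite exprn_ge0.
rewrite (bigID (fun i : 'I_n => (i < l)%N)) /=; apply: ler_pM.
- exact: prodr_ge0.
- exact: prodr_ge0.
- rewrite -{2 3}(card_ord_lt ln); apply: prod_le_mean_exp => //.
  exact: total.
- rewrite (eq_bigr (fun j => \sum_i `|(A *m map_mx Num.conj U^T) i j| ^+ 2)).
    rewrite -(card_ord_ge ln); apply: prod_le_mean_exp => //.
    exact: total.
  move=> j; rewrite -leqNgt => lj; apply: eq_bigr => i _.
  rewrite mulmxDl [X in `|X|]mxE mul_trmxC_schmidt_row_ebase0 ?addr0 //.
  exact: leq_trans lj.
Qed.

Section Frobenius.
Variable R : realType.

Lemma normc_ge0 (z : R[i]) : 0 <= Normc.normc z.
Proof. by case: z => x y; exact: sqrtr_ge0. Qed.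

Lemma normcEC (z : R[i]) : `|z| = (Normc.normc z)%:C.
Proof. by []. Qed.

Lemma frobenius_sqr m n (A : 'M[R[i]]_(m, n)) :
  (frobenius_norm A ^+ 2)%:C = \sum_i \sum_j `|A i j| ^+ 2.
Proof.
rewrite sqr_sqrtr; last by do 2![apply: sumr_ge0 => ? _]; rewrite sqr_ge0.
rewrite rmorph_sum; apply: eq_bigr => i _; rewrite rmorph_sum.
by apply: eq_bigr => j _; rewrite rmorphXn.
Qed.

Lemma frobenius_norm_ge0 m n (A : 'M[R[i]]_(m, n)) : 0 <= frobenius_norm A.
Proof. exact: sqrtr_ge0. Qed.

Lemma frobenius_norm_eq0 m n (A : 'M[R[i]]_(m, n)) :
  frobenius_norm A = 0 -> A = 0.
Proof.
move=> A0; have := frobenius_sqr A; rewrite A0 expr0n /= => /esym/eqP.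
rewrite psumr_eq0 => [/allP H|i _]; last first.
  by apply: sumr_ge0 => j _; rewrite exprn_ge0.
apply/matrixP => i j; rewrite mxE; apply/eqP.
have := H i (mem_index_enum i); rewrite psumr_eq0 => [/allP H'|k _].
  by have := H' j (mem_index_enum j); rewrite expf_eq0 /= normr_eq0.
by rewrite exprn_ge0.
Qed.

Lemma frobenius_normD m n (A B : 'M[R[i]]_(m, n)) :
  frobenius_norm (A + B) <= frobenius_norm A + frobenius_norm B.
Proof.
have sqrE (M : 'M[R[i]]_(m, n)) :
    frobenius_norm M ^+ 2 = \sum_i \sum_j Normc.normc (M i j) ^+ 2.
  by rewrite sqr_sqrtr //; do 2![apply: sumr_ge0 => ? _]; rewrite sqr_ge0.
(* Zero norms are settled first, since the main argument cancels the factor [x * y]. *)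
have [A0|A0] := eqVneq (frobenius_norm A) 0.
  by rewrite A0 add0r (frobenius_norm_eq0 A0) add0r.
have [B0|B0] := eqVneq (frobenius_norm B) 0.
  by rewrite B0 addr0 (frobenius_norm_eq0 B0) addr0.
have := sqrE A; have := sqrE B.
have : 0 < frobenius_norm B by rewrite lt0r B0 frobenius_norm_ge0.
have : 0 < frobenius_norm A by rewrite lt0r A0 frobenius_norm_ge0.
set x := frobenius_norm A; set y := frobenius_norm B => x0 y0 yE xE.
rewrite -(@ler_pXn2r _ 2) ?nnegrE ?frobenius_norm_ge0 ?addr_ge0 ?(ltW x0) ?(ltW y0) //.
have xy0 : 0 < x * y by rewrite mulr_gt0.
rewrite -(ler_pM2l xy0) sqrE.
(* Cauchy-Schwarz in weighted form, so that the bound is entrywise: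
   [xy (a + b)^2 <= (x + y) (y a^2 + x b^2)], with equality when [y a = x b]. *)
have -> : x * y * (x + y) ^+ 2 = (x + y) * (y * x ^+ 2 + x * y ^+ 2) by ring.
rewrite xE yE !mulr_sumr -big_split /= mulr_sumr; apply: ler_sum => i _.
rewrite !mulr_sumr -big_split /= mulr_sumr; apply: ler_sum => j _.
rewrite mxE; set a := Normc.normc (A i j); set b := Normc.normc (B i j).
have ab : Normc.normc (A i j + B i j) <= a + b by exact: le_normcD.
apply: (@le_trans _ _ (x * y * (a + b) ^+ 2)).
  rewrite ler_wpM2l ?(ltW xy0) // lerXn2r ?nnegrE ?normc_ge0 //.
  by rewrite addr_ge0 ?normc_ge0.
rewrite -subr_ge0.
have -> : (x + y) * (y * a ^+ 2 + x * b ^+ 2) - x * y * (a + b) ^+ 2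
  = (y * a - x * b) ^+ 2 by ring.
exact: sqr_ge0.
Qed.

End Frobenius.

Theorem lemma3p2 (R : realType) (n l : nat) (n_ge1 : (1 <= n)%N)
    (l_le_n : (l <= n)%N) (C : R) (A B : 'M[R[i]]_n)
    (normA : frobenius_norm A <= n%:R) (normB : frobenius_norm B <= C * n%:R)
    (rankB : (\rank B <= l)%N) :
  Normc.normc (\det (A + B)) <=
    n%:R ^+ n
      / ((n - l)%N%:R `^ ((n - l)%N%:R / 2) * l%:R `^ (l%:R / 2))
      * (1 + C) ^+ l.
Proof.
have n0 : 0 < n%:R :> R by rewrite ltr0n.
(* The sign of [C] is forced by [normB]; it makes the right-hand side nonnegative, so that both
   sides may be squared. *)
have C0 : 0 <= C.
  by rewrite -(pmulr_lge0 _ n0) (le_trans (frobenius_norm_ge0 B)).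
have normAB : frobenius_norm (A + B) <= (1 + C) * n%:R.
  by rewrite mulrDl mul1r (le_trans (frobenius_normD A B)) ?lerD.
have leS (M : 'M[R[i]]_n) (b : R) : frobenius_norm M <= b ->
    \sum_i \sum_j `|M i j| ^+ 2 <= (b ^+ 2)%:C.
  move=> leb; rewrite -frobenius_sqr lecR.
  have b0 := le_trans (frobenius_norm_ge0 M) leb.
  by rewrite lerXn2r ?nnegrE ?frobenius_norm_ge0.
have := det_add_low_rank_bound l_le_n rankB (leS _ _ normA) (leS _ _ normAB).
rewrite normcEC -!(rmorph_nat (real_complex R)) -!fmorph_div -!(rmorphXn (real_complex R)) -rmorphM.
rewrite lecR => H.
(* This includes [k = 0], where both powers equal 1. *)
have half (k : nat) : (k%:R `^ (k%:R / 2)) ^+ 2 = k%:R ^+ k :> R.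
  by rewrite -powR_mulrn ?powR_ge0 // -powRrM divfK ?pnatr_eq0 // powR_mulrn.
rewrite -(@ler_pXn2r _ 2) //; last 2 first.
- by rewrite nnegrE normc_ge0.
- by rewrite nnegrE !mulr_ge0 ?invr_ge0 ?mulr_ge0 ?powR_ge0 ?exprn_ge0 ?addr_ge0 ?ler0n.
(* The bound in [H] is exactly the square of the target; splitting [n%:R ^+ n] over the two groups
   of columns shows it. *)
apply: le_trans H _; rewrite le_eqVlt; apply/orP; left; apply/eqP.
rewrite !exprMn !exprVn !exprMn !half invfM.
have -> : n%:R ^+ n = n%:R ^+ l * n%:R ^+ (n - l) :> R.
  by rewrite -exprD subnKC.
ring.
Qed.
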